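(* There exists a positive integer $t$ such that for every positive integer $g$ there is a constant $c>0$ (depending only on $g$ and $t$) with the following property: for every integer $n\geq 3$ there exists a semilinear graph $G$ of complexity $t$ such that the girth of $G$ is at least $g$, $G$ contains no independent set of size $n$, and $G$ has at least $c\,n\log\log n$ vertices.
   Context: A function $f:\mathbb{R}^{m}\to\mathbb{R}$ is linear if $f(\mathbf{x})=b+\sum_{i=1}^m a_i\mathbf{x}(i)$ for some reals $a_1,\dots,a_m,b$. A (finite, simple) graph $G$ is semilinear of complexity $t$ if $V(G)\subset\mathbb{R}^d$ for some positive integer $d$, and there are $t$ linear functions $f_1,\dots,f_t:\mathbb{R}^d\times\mathbb{R}^d\to\mathbb{R}$ and a Boolean function $\phi:\{\mathrm{F},\mathrm{T}\}^{3t}\to\{\mathrm{F},\mathrm{T}\}$ such that for distinct $\mathbf{x},\mathbf{y}\in V(G)$, $\{\mathbf{x},\mathbf{y}\}$ is an edge iff $\phi\big(\{f_i(\mathbf{x},\mathbf{y})<0,\ f_i(\mathbf{x},\mathbf{y})\leq 0,\ f_i(\mathbf{x},\mathbf{y})=0\}_{i\in[t]}\big)=\mathrm{T}$; it is assumed that this truth value is unchanged when $\mathbf{x}$ and $\mathbf{y}$ are swapped. The girth of a graph is the length of its shortest cycle (infinite if acyclic). *)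

(* Defs.v *)
From Stdlib Require Import Rdefinitions Rpower.
From HB Require Import structures.
From mathcomp Require Import all_boot all_order all_algebra.
From mathcomp Require Import Rstruct.
Set Implicit Arguments. Unset Strict Implicit. Unset Printing Implicit Defensive.
Import Order.TTheory GRing.Theory Num.Theory.
Local Open Scope ring_scope.

Record lin2 (d : nat) := Lin2 { lin_b : R ; lin_a1 : 'rV[R]_d ; lin_a2 : 'rV[R]_d }.

Definition lin2_eval (d : nat) (f : lin2 d) (x y : 'rV[R]_d) : R :=
  lin_b f + \sum_(i < d) lin_a1 f 0 i * x 0 i + \sum_(i < d) lin_a2 f 0 i * y 0 i.

Definition sign_pattern (d t : nat) (fs : 'I_t -> lin2 d) (x y : 'rV[R]_d)
  : {ffun 'I_t -> bool * bool * bool} :=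
  [ffun i => (lin2_eval (fs i) x y < 0, lin2_eval (fs i) x y <= 0,
              lin2_eval (fs i) x y == 0)].

Record semilinear_graph (d t : nat) := SLGraph {
  sl_V   : seq 'rV[R]_d ;
  sl_f   : 'I_t -> lin2 d ;
  sl_phi : {ffun 'I_t -> bool * bool * bool} -> bool }.

Definition sl_wf (d t : nat) (G : semilinear_graph d t) : Prop :=
  (0 < d)%N /\ uniq (sl_V G) /\
  forall x y, x \in sl_V G -> y \in sl_V G -> x != y ->
    sl_phi G (sign_pattern (sl_f G) x y) = sl_phi G (sign_pattern (sl_f G) y x).

Definition sl_adj (d t : nat) (G : semilinear_graph d t) : rel 'rV[R]_d :=
  fun x y => [&& x \in sl_V G, y \in sl_V G, x != y &
                 sl_phi G (sign_pattern (sl_f G) x y)].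

Definition sl_nverts (d t : nat) (G : semilinear_graph d t) : nat := size (sl_V G).

Definition has_cycle_of_length (T : eqType) (V : seq T) (adj : rel T) (k : nat) : Prop :=
  exists c : seq T, [/\ (3 <= k)%N, size c = k, uniq c, {subset c <= V} & cycle adj c].

(* girth >= g : no cycle of length < g (girth is infinite if acyclic). *)
Definition girth_at_least (T : eqType) (V : seq T) (adj : rel T) (g : nat) : Prop :=
  forall k, (k < g)%N -> ~ has_cycle_of_length V adj k.

Definition has_independent_set (T : eqType) (V : seq T) (adj : rel T) (n : nat) : Prop :=
  exists S : seq T, [/\ size S = n, uniq S, {subset S <= V} &
                       forall x y, x \in S -> y \in S -> ~~ adj x y].

(* Main.v *)
Require Import Defs.
From Stdlib Require Import Rdefinitions Rpower.
From HB Require Import structures.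
From mathcomp Require Import all_boot all_order all_algebra.
From mathcomp Require Import Rstruct zify.
From Stdlib Require Import Rtrigo_def.
Set Implicit Arguments. Unset Strict Implicit. Unset Printing Implicit Defensive.
Import Order.TTheory GRing.Theory Num.Theory.

(** A vertex is a point [p] of a [B q^q] by [q^q] grid together with a shape
    [j < q]; its box is the cell containing [p] in the partition of the grid
    into boxes of sides [q^j] and [q^(q-j)].  Two vertices are adjacent when one
    of the points lies in the box of the other, which is a semilinear condition
    of complexity 8.  All boxes have the same area, and boxes of different
    shapes meet in at most a [1/q] fraction of it.

    If [f p] is the fraction of the shapes [j] for which [(p, j)] is in a set
    [A] of vertices, then averaging [f] over the boxes of the members of [A]
    gives at least the mean of [f^2], so by Cauchy--Schwarz a set of density [δ]
    contains a box of relative mass [δ^2].  Hence (Kleitman--Winston) few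
    [n]-tuples are independent, and in a random sample of [N = 2 K n] vertices
    no [n] are independent, although a box has only [μ = 2^O(K)] sample points.  A short
    cycle costs an extra factor [O(1/q)] compared to a path: some vertex on it
    is joined to its two neighbours through boxes of two different vertices,
    and these have equal shapes with probability [1/q] and otherwise intersect
    in a [1/q] fraction of a box.  So once [q] exceeds a power of [μ], deleting
    one vertex from each short cycle removes less than half of the sample.
    Here [q = 2^O(g K)], so that [q^q], and with it the least admissible [n], is
    doubly exponential in [K]. *)

(** * Cauchy--Schwarz and the counting of random maps *)

Lemma sum_sqr_leq (X : finType) (f : X -> nat) :
  (\sum_p f p) ^ 2 <= #|X| * \sum_p f p ^ 2.
Proof.
rewrite -(leq_pmul2l (isT : 0 < 2)) -mulnn big_distrlr /= big_distrr /=.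
under eq_bigr do rewrite big_distrr /=.
apply: (@leq_trans (\sum_(i : X) \sum_(j : X) (f i ^ 2 + f j ^ 2))).
  by apply: leq_sum => i _; apply: leq_sum => j _; apply: nat_Cauchy.
under eq_bigr do rewrite big_split /= sum_nat_const.
by rewrite big_split /= sum_nat_const -big_distrr /= addnn mul2n.
Qed.

(** In a uniformly random map [P] the values at distinct indices are independent and uniform:
    prescribing them on [s] leaves the other coordinates free, so all fibres have the same size.
    Probabilities are written as counts, without division. *)
Lemma card_marginal (I H : finType) (x0 : H) (k : nat) (s : k.-tuple I)
    (E : pred (k.-tuple H)) :
  uniq s ->
  #|[set P : {ffun I -> H} | E (map_tuple P s)]| * #|H| ^ k = #|E| * #|H| ^ #|I|.
Proof.
move=> us.
have fib (t : k.-tuple H) :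
    #|[set P : {ffun I -> H} | map_tuple P s == t]| * #|H| ^ k = #|H| ^ #|I|.
  pose F i := if i \in s then pred1 (nth x0 t (index i s)) else predT.
  have -> : #|[set P : {ffun I -> H} | map_tuple P s == t]| = #|(family F : simpl_pred _)|.
    apply: eq_card => P; rewrite inE; apply/eqP/familyP => [tE i|fP].
      rewrite /F; case: ifP => [si|//].
      by apply/eqP; rewrite -tE /= (nth_map i) ?index_mem ?nth_index.
    apply/val_inj/(@eq_from_nth _ x0) => [|i]; first by rewrite /= size_map !size_tuple.
    rewrite /= size_map => lti.
    have i0 : I by move: lti; case: (val s).
    rewrite (nth_map i0) //; have := fP (nth i0 s i).
    by rewrite /F mem_nth // inE index_uniq // => /eqP.
  rewrite card_family foldrE big_map big_enum /= (bigID [in s]) /=.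
  rewrite big1 => [|i si]; last by rewrite /F si card1.
  rewrite mul1n (eq_bigr (fun=> #|H|)) => [|i si]; last by rewrite /F (negbTE si).
  rewrite prod_nat_const -expnD; congr (_ ^ _).
  by have := cardC [in s]; rewrite (card_uniqP us) size_tuple addnC => <-.
rewrite -[X in X * _ = _]sum1_card.
rewrite (partition_big (fun P : {ffun I -> H} => map_tuple P s) E) /=;
  last by move=> P; rewrite inE.
rewrite big_distrl /= -sum_nat_const; apply: eq_bigr => t Et.
rewrite -(fib t); congr (_ * _); rewrite -sum1_card; apply: eq_bigl => P.
by rewrite !inE; case: eqP => [->|]; rewrite ?andbF // andbT.
Qed.

Lemma card_tuple_leq (T : finType) (k : nat) (E : pred (k.-tuple T)) (L : seq (seq T)) :
  (forall t, E t -> val t \in L) -> #|E| <= size L.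
Proof.
move=> EL; rewrite cardE -(size_map val); apply: uniq_leq_size.
  by rewrite map_inj_uniq ?enum_uniq //; apply: val_inj.
by move=> _ /mapP[t + ->]; rewrite mem_enum; apply: EL.
Qed.

(** * The host graph and its independent sequences *)

Section Host.

Variables (X J Y : finType) (cl : J -> X -> Y).
Local Notation H := (X * J)%type.

(** The shape of [w] is ignored. The relation is reflexive, so two copies of one vertex in a sample
    count as adjacent. *)
Definition out : rel H := fun v w => cl v.2 v.1 == cl v.2 w.1.
Definition adj : rel H := fun v w => out v w || out w v.

Lemma card_shapes (A : {set H}) : #|A| = \sum_j #|[set p | (p, j) \in A]|.
Proof.
rewrite -sum1_card (eq_bigl (fun u => (u.1, u.2) \in A)) => [|[] //].
rewrite -(pair_big_dep xpredT (fun p j => (p, j) \in A) (fun _ _ => 1)) /=.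
rewrite (exchange_big_dep xpredT) //=; apply: eq_bigr => j _.
by rewrite -sum1_card; apply: eq_bigl => p; rewrite inE.
Qed.

(** Let [f p] count the shapes over [p] in [A]. The sum of [f p ^ 2] is the sum of [f p] over the
    members [(p, j)] of [A]; grouped by cells, each of the [#|J| * #|Y|] cells contributes at most
    the degree of a member whose box it is, or nothing. Cauchy--Schwarz concludes. *)
Lemma supersaturation (A : {set H}) (tau : nat) :
  (forall v, v \in A -> #|[set w in A | out v w]| < tau) ->
  #|A| ^ 2 <= #|{: H}| * #|Y| * tau.
Proof.
move=> lo; pose f p := \sum_j ((p, j) \in A : nat).
have -> : #|A| = \sum_p f p.
  rewrite /f exchange_big /= card_shapes; apply: eq_bigr => j _.
  by rewrite -sum1_card big_mkcond /=; apply: eq_bigr => p _; rewrite inE; case: ifP.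
apply: leq_trans (sum_sqr_leq f) _; rewrite card_prod -!mulnA leq_mul2l; apply/orP; right.
have -> : \sum_p f p ^ 2 = \sum_j \sum_(p | (p, j) \in A) f p.
  under [RHS]eq_bigr do rewrite big_mkcond.
  rewrite exchange_big /=; apply: eq_bigr => p _.
  rewrite -mulnn {1}/f big_distrl /=; apply: eq_bigr => j _.
  by case: ifP; rewrite ?mul1n ?mul0n.
rewrite -sum_nat_const; apply: leq_sum => j _; rewrite -sum_nat_const.
rewrite (partition_big (cl j) xpredT) //=; apply: leq_sum => y _.
case: (pickP [pred p | ((p, j) \in A) && (cl j p == y)]) => [p0 /andP[Ap0 /eqP clp0]|no].
  apply: leq_trans (ltnW (lo _ Ap0)).
  rewrite card_shapes exchange_big /=; apply: leq_sum => j' _.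
  rewrite -sum1_card big_mkcond [leqRHS]big_mkcond /=; apply: leq_sum => p _.
  rewrite !inE /out /= clp0 [y == _]eq_sym.
  by case: (cl j p == y); case: ((p, j) \in A); case: ((p, j') \in A).
by rewrite big_pred0 // => p; apply: no.
Qed.

(** Only the vertices with a point in the box of [v] are removed, so sequences that are not
    independent may be listed too; an upper bound tolerates this. *)
Fixpoint indep_seqs (A : {set H}) (n : nat) : seq (seq H) :=
  if n is n'.+1 then
    [seq v :: s | v <- enum A, s <- indep_seqs (A :\: [set w | out v w]) n']
  else [:: [::]].

Lemma mem_indep_seqs (A : {set H}) (s : seq H) :
  {subset s <= A} -> pairwise (fun v w => ~~ adj v w) s ->
  s \in indep_seqs A (size s).
Proof.
elim: s A => [|v s IH] A sA //= /andP[/allP vs ps].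
apply/allpairsPdep; exists v, s; split=> //.
  by rewrite mem_enum sA ?mem_head.
apply: IH ps => w sw; have := vs _ sw; rewrite /adj negb_or => /andP[nvw _].
by rewrite !inE nvw sA // inE sw orbT.
Qed.

(* Kleitman--Winston: a chosen vertex either has large degree into the set [A]
   of still available vertices, which shrinks [A] by [tau] and so happens at
   most [r] times, or it belongs to the at most [#|H| / D] vertices of low
   degree. *)
Lemma size_indep_seqs (D tau : nat) (A : {set H}) (n r : nat) :
  0 < D -> #|Y| * tau * D ^ 2 <= #|{: H}| -> #|A| <= r * tau ->
  D ^ n * size (indep_seqs A n) <= (2 * #|{: H}|) ^ n * D ^ r.
Proof.
move=> D0 tauE; elim: n A r => [|n IH] A r Ar /=.
  by rewrite !expn0 !mul1n expn_gt0 D0.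
rewrite size_allpairs_dep sumnE big_map big_enum /= big_distrr /=.
pose hi := [set v in A | tau <= #|[set w in A | out v w]|].
set h := #|{: H}| in tauE IH *.
have lowA : #|A :\: hi| * D <= h.
  rewrite leqNgt; apply/negP => lt.
  have sup : #|A :\: hi| ^ 2 <= h * #|Y| * tau.
    apply: supersaturation => v; rewrite !inE => /andP[+ vA].
    rewrite vA /= -ltnNge; apply: leq_ltn_trans.
    by apply/subset_leq_card/subsetP => w; rewrite !inE => /andP[/andP[_ ->] ->].
  suff : h ^ 2 < h ^ 2 by rewrite ltnn.
  apply: (@leq_trans ((#|A :\: hi| * D) ^ 2)); first by rewrite ltn_sqr.
  rewrite expnMn; apply: (@leq_trans (h * (#|Y| * tau * D ^ 2))).
    rewrite [leqRHS](_ : _ = h * #|Y| * tau * D ^ 2); last by lia.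
    by rewrite leq_mul2r sup orbT.
  by rewrite -[leqRHS]mulnn leq_mul2l tauE orbT.
(* One half of the factor [2 * h] pays for the choices of high degree, which use up one factor [D]
   of [D ^ r], the other for the at most [h / D] choices of low degree. *)
set K := (2 * h) ^ n * D ^ r.
rewrite (big_setID hi) /= [leqRHS](_ : _ = h * K + h * K); last first.
  by rewrite expnS /K; lia.
apply: leq_add.
  apply: (@leq_trans (\sum_(v in A :&: hi) K)); last first.
    by rewrite sum_nat_const leq_mul2r max_card orbT.
  apply: leq_sum => v; rewrite !inE => /andP[_ /andP[vA degv]].
  have Nv : [set w in A | out v w] = A :&: [set w | out v w].
    by apply/setP => w; rewrite !inE.
  case: r Ar @K => [|r] Ar K.
    by move: Ar; rewrite mul0n leqn0 cards_eq0 => /eqP E; rewrite E inE in vA.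
  rewrite /K expnS -mulnA [D ^ r.+1]expnS [leqRHS]mulnCA leq_mul2l; apply/orP; right.
  apply: IH; rewrite cardsD leq_subLR; apply: leq_trans Ar _.
  by rewrite mulSn leq_add2r -Nv.
apply: (@leq_trans (\sum_(v in A :\: hi) D * K)).
  apply: leq_sum => v _; rewrite expnS -mulnA leq_mul2l; apply/orP; right.
  by apply: IH; apply: leq_trans Ar; apply/subset_leq_card/subsetDl.
by rewrite sum_nat_const mulnA leq_mul2r lowA orbT.
Qed.

(** * Degrees, codegrees and short closed walks *)

Variable c : nat.
Hypothesis cell_card : forall j y, #|[set p | cl j p == y]| <= c.
Hypothesis cell_cap : forall j j' y y', j != j' ->
  #|[set p | (cl j p == y) && (cl j' p == y')]| * #|J| <= c.

Lemma card_adj v : #|[set w | adj v w]| <= 2 * c * #|J|.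
Proof.
have cells (A : {set H}) (y : J -> Y) (k : J -> J) :
    (forall p j, (p, j) \in A -> cl (k j) p == y j) -> #|A| <= c * #|J|.
  move=> Ay; rewrite card_shapes mulnC -sum_nat_const; apply: leq_sum => j _.
  apply: leq_trans (cell_card (k j) (y j)); apply/subset_leq_card/subsetP => p.
  by rewrite !inE; apply: Ay.
have -> : [set w | adj v w] = [set w | out v w] :|: [set w | out w v].
  by apply/setP => w; rewrite !inE.
apply: leq_trans (leq_card_setU _ _) _; rewrite -mulnA mul2n -addnn leq_add //.
  by apply: (cells _ (fun=> cl v.2 v.1) (fun=> v.2)) => p j; rewrite inE eq_sym.
by apply: (cells _ (fun j => cl j v.1) id) => p j; rewrite inE.
Qed.

(* [w] is adjacent to [u] and [x] through boxes of two different vertices. *)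
Definition pass (u w x : H) :=
  [|| out u w && out x w, out w u && out x w | out u w && out w x].

(** Boxes of different shapes share at most [c / #|J|] points, so all shapes of [w] together give
    [c], and one exceptional shape another [c]: [2 * c] for each of the three cases. Only when both
    boxes belong to [u] and [x] can their shapes agree for every [w]. *)
Lemma card_pass u x :
  #|[set w | pass u w x]| <= 6 * c + (u.2 == x.2) * (c * #|J|).
Proof.
have few (A : {set H}) j0 :
    (forall j, j != j0 -> #|[set p | (p, j) \in A]| * #|J| <= c) ->
    #|[set p | (p, j0) \in A]| <= c -> #|A| <= 2 * c.
  move=> Aj Aj0; rewrite card_shapes (bigD1 j0) //= mul2n -addnn leq_add //.
  rewrite -(@leq_pmul2r #|J|); last by apply/card_gt0P; exists j0.
  rewrite big_distrl /= mulnC -sum_nat_const [leqRHS](bigID (predC1 j0)) /=.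
  by apply: leq_trans (leq_addr _ _); apply: leq_sum => j; apply: Aj.
have cap (A : {set X}) j j' y y' : j != j' ->
    (forall p, p \in A -> (cl j p == y) && (cl j' p == y')) -> #|A| * #|J| <= c.
  move=> jj' Ay; apply: leq_trans (cell_cap y y' jj').
  by rewrite leq_mul2r; apply/orP; right; apply/subset_leq_card/subsetP => p /Ay; rewrite inE.
have cell (A : {set X}) j y : (forall p, p \in A -> cl j p == y) -> #|A| <= c.
  move=> Ay; apply: leq_trans (cell_card j y).
  by apply/subset_leq_card/subsetP => p /Ay; rewrite inE.
have -> : [set w | pass u w x] = [set w | out u w && out x w]
    :|: ([set w | out w u && out x w] :|: [set w | out u w && out w x]).
  by apply/setP => w; rewrite !inE.
apply: leq_trans (leq_card_setU _ _) _.
apply: (@leq_trans ((2 * c + (u.2 == x.2) * (c * #|J|)) + (2 * c + 2 * c))); last by lia.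
apply: leq_add; last (apply: leq_trans (leq_card_setU _ _) _; apply: leq_add).
- case: eqVneq => [ux|ux].
    apply: (@leq_trans (c * #|J|)); last by lia.
    rewrite card_shapes mulnC -sum_nat_const; apply: leq_sum => j _.
    by apply: (cell _ u.2 (cl u.2 u.1)) => p; rewrite !inE /out /= eq_sym => /andP[].
  rewrite addn0; apply: (few _ x.2) => [j jx|].
    by apply: (cap _ u.2 x.2 (cl u.2 u.1) (cl x.2 x.1)) => // p;
      rewrite !inE /out /= eq_sym [_ == cl x.2 p]eq_sym.
  by apply: (cell _ u.2 (cl u.2 u.1)) => p; rewrite !inE /out /= eq_sym => /andP[].
- apply: (few _ x.2) => [j jx|].
    by apply: (cap _ j x.2 (cl j u.1) (cl x.2 x.1)) => // p;
      rewrite !inE /out /= [_ == cl x.2 p]eq_sym.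
  by apply: (cell _ x.2 (cl x.2 x.1)) => p; rewrite !inE /out /= [_ == cl x.2 p]eq_sym => /andP[].
apply: (few _ u.2) => [j ju|].
  by apply: (cap _ j u.2 (cl j x.1) (cl u.2 u.1)) => // p;
      rewrite !inE /out /= andbC [_ == cl u.2 p]eq_sym.
by apply: (cell _ u.2 (cl u.2 u.1)) => p; rewrite !inE /out /= eq_sym => /andP[].
Qed.

Fixpoint walks (x : H) (k : nat) : seq (seq H) :=
  if k is k'.+1 then [seq y :: p | y <- enum [set y | adj x y], p <- walks y k']
  else [:: [::]].

Lemma mem_walks x p : path adj x p -> p \in walks x (size p).
Proof.
elim: p x => [|y p IH] x //= /andP[xy yp].
by apply/allpairsPdep; exists y, p; rewrite mem_enum inE xy IH.
Qed.

Lemma size_walks x k : size (walks x k) <= (2 * c * #|J|) ^ k.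
Proof.
elim: k x => [|k IH] x //=; rewrite size_allpairs_dep sumnE big_map big_enum /= expnS.
apply: leq_trans (leq_mul (card_adj x) (leqnn _)); rewrite -sum_nat_const.
by apply: leq_sum => y _; apply: IH.
Qed.

(** Prescribing the last shape saves a factor [#|J|] on [size_walks]: the last step then chooses a
    point in one of two boxes. *)
Lemma sum_walks_last x k j :
  \sum_(p <- walks x k.+1) ((last x p).2 == j : nat) <= (2 * c * #|J|) ^ k * (2 * c).
Proof.
elim: k x => [|k IH] x.
  rewrite mul1n big_allpairs_dep big_enum /=; under eq_bigr do rewrite big_seq1.
  rewrite -big_mkcondr /= sum1_card.
  have -> : #|[pred i in [set y | adj x y] | i.2 == j]| =
      #|[set p | adj x (p, j)]|.
    rewrite -(card_imset _ (f := fun p => (p, j))); last by move=> p p' [].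
    apply: eq_card => -[p j']; rewrite !inE /=; apply/andP/imsetP => [[xp /eqP <-]|].
      by exists p; rewrite ?inE.
    by case=> p'; rewrite inE => xp' [-> ->]; rewrite xp' eqxx.
  have -> : [set p | adj x (p, j)] =
      [set p | cl x.2 p == cl x.2 x.1] :|: [set p | cl j p == cl j x.1].
    by apply/setP => p; rewrite !inE [_ == cl x.2 x.1]eq_sym.
  by apply: leq_trans (leq_card_setU _ _) _; rewrite mul2n -addnn leq_add.
rewrite big_allpairs_dep big_enum /= expnS -mulnA.
apply: leq_trans (leq_mul (card_adj x) (leqnn _)); rewrite -sum_nat_const.
by apply: leq_sum => y _; apply: IH.
Qed.

Definition bad (s : seq H) : bool :=
  if s is w :: x :: p then path adj x p && pass (last x p) w x else false.

Definition bad_seqs (m : nat) : seq (seq H) :=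
  [seq s | x <- enum {: H}, s <-
     [seq w :: x :: p | p <- walks x m.+1, w <- enum [set w | pass (last x p) w x]]].

Lemma mem_bad_seqs s m : size s = m.+3 -> bad s -> s \in bad_seqs m.
Proof.
case: s => [|w [|x p]] //= [sp] /andP[xp wp].
apply/allpairsPdep; exists x, [:: w, x & p]; rewrite mem_enum; split=> //.
by apply/allpairsPdep; exists p, w; rewrite mem_enum inE wp -sp mem_walks.
Qed.

(** The term [c * #|J|] of [card_pass] needs the ends of the walk to have equal shapes, which costs
    a factor [#|J|]; it thus adds only [c] to [6 * c]. *)
Lemma size_bad_seqs m :
  size (bad_seqs m) <= #|{: H}| * (2 * c * #|J|) ^ m.+1 * (7 * c).
Proof.
rewrite size_allpairs_dep sumnE big_map big_enum /= -mulnA -sum_nat_const.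
apply: leq_sum => x _; rewrite size_allpairs_dep sumnE big_map.
apply: (@leq_trans (\sum_(p <- walks x m.+1)
    (6 * c + (c * #|J|) * ((last x p).2 == x.2)))).
  by apply: leq_sum => p _; rewrite -cardE [_ * (_ == _)]mulnC; apply: card_pass.
have := sum_walks_last x m x.2; have := size_walks x m.+1.
set L := walks x m.+1 => Ls Ll; rewrite big_split /= -[X in _ + X <= _]big_distrr /=.
rewrite big_const_seq count_predT iter_addn_0.
apply: leq_trans (leq_add (leq_mul (leqnn _) Ls) (leq_mul (leqnn _) Ll)) _.
have E j K : 6 * c * (2 * c * j * K) + c * j * (K * (2 * c)) <= 2 * c * j * K * (7 * c) by lia.
by rewrite expnS; apply: E.
Qed.

(* If [bad s] fails, the first vertex is joined to both its neighbours through its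
   own box only; then its successor is joined through that box to it, and through
   another vertex's box to the next vertex. *)
Lemma cycle_bad s : 3 <= size s -> cycle adj s -> bad s || bad (rot 1 s).
Proof.
case: s => [|w [|x [|y p]]] // _.
rewrite /rot /= cats1 last_rcons !rcons_path => /and3P[wx xy /andP[yp lw]].
rewrite xy yp lw; move: wx xy lw; rewrite /pass /adj.
move: (last y p) => u; case: (out u w); case: (out w u); case: (out w x);
by case: (out x w); case: (out x y); case: (out y x).
Qed.

(** * First moments of a random sample, and deletion *)

Hypothesis card_X : #|X| = #|Y| * c.
Variable h0 : H.

Let h_gt0 : 0 < #|{: H}|. Proof. by apply/card_gt0P; exists h0. Qed.

(** A given index tuple is bad with probability at most [7 * 2 ^ m.+1 / (#|J| * #|Y| ^ m.+2)]. There
    are at most [N ^ m.+3] tuples, and [N / #|Y| <= mu]. *)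
Lemma sum_bad (N m mu g : nat) : 0 < mu -> N <= mu * #|Y| -> m < g ->
  #|J| * \sum_(P : {ffun 'I_N -> H})
     #|[set s : m.+3.-tuple 'I_N | uniq s && bad (map P s)]|
  <= 7 * (2 * mu) ^ g.+2 * (N * #|{: H}| ^ N).
Proof.
move=> mu0 Nmu mg; set h := #|{: H}|.
pose S := \sum_(s : m.+3.-tuple 'I_N | uniq s)
   #|[set P : {ffun 'I_N -> H} | bad (map_tuple P s)]|.
have -> : \sum_(P : {ffun 'I_N -> H})
    #|[set s : m.+3.-tuple 'I_N | uniq s && bad (map P s)]| = S.
  under eq_bigr do rewrite -sum1dep_card.
  rewrite (exchange_big_dep (fun s : m.+3.-tuple 'I_N => uniq s)) /=; last by move=> ? ? _ /andP[].
  apply: eq_bigr => s us; rewrite -sum1dep_card.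
  by apply: eq_bigl => P; rewrite us.
have cJ : h = #|Y| * (c * #|J|) by rewrite /h card_prod card_X; lia.
have each (s : m.+3.-tuple _) : uniq s -> #|J| * #|Y| ^ m.+2 *
    #|[set P : {ffun 'I_N -> H} | bad (map_tuple P s)]| <= 7 * 2 ^ m.+1 * h ^ N.

  move=> us; rewrite -(@leq_pmul2r (h ^ m.+3)) ?expn_gt0 ?h_gt0 // -mulnA.
  rewrite (@card_marginal _ _ h0 _ s (fun t => bad (val t))) // card_ord.
  apply: (@leq_trans (#|J| * #|Y| ^ m.+2 *
      ((h * (2 * c * #|J|) ^ m.+1 * (7 * c)) * h ^ N))).
    rewrite leq_mul2l; apply/orP; right; rewrite leq_mul2r; apply/orP; right.
    apply: leq_trans (size_bad_seqs m).
    by apply: card_tuple_leq => t; apply: mem_bad_seqs; rewrite size_tuple.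
  have E (j y K a Z : nat) : a = y * (c * j) ->
    j * (y * y ^ m.+1) * ((a * K) * (7 * c) * Z) <= 7 * Z * (a * a * (y ^ m.+1 * K)).
    by move=> ->; lia.
  rewrite [#|Y| ^ _]expnS; apply: leq_trans (E _ _ _ _ _ cJ) _.
  rewrite -expnMn (_ : #|Y| * (2 * c * #|J|) = 2 * h); last by rewrite cJ; lia.
  by rewrite expnMn [h ^ m.+3]expnS [h ^ m.+2]expnS; lia.
have SN : #|J| * #|Y| ^ m.+2 * S <= N ^ m.+3 * (7 * 2 ^ m.+1 * h ^ N).
  rewrite /S big_distrr /=.
  apply: (@leq_trans (\sum_(s : m.+3.-tuple 'I_N | uniq s) 7 * 2 ^ m.+1 * h ^ N)).
    by apply: leq_sum => s; apply: each.
  rewrite sum_nat_const leq_mul2r; apply/orP; right.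
  apply: leq_trans (max_card _) _.
  by rewrite card_tuple card_ord.
case: (posnP #|Y|) => [Y0|Y_gt0].
  by move: h_gt0; rewrite -/h cJ Y0.
have Yp : 0 < #|Y| ^ m.+2 by rewrite expn_gt0 Y_gt0.
rewrite -(leq_pmul2l Yp); apply: (@leq_trans (N ^ m.+3 * (7 * 2 ^ m.+1 * h ^ N))).
  by apply: leq_trans SN; rewrite mulnCA mulnA.
rewrite expnS.
have mono : N ^ m.+2 * 2 ^ m.+1 <= #|Y| ^ m.+2 * (2 * mu) ^ g.+2.
  apply: (@leq_trans ((mu * #|Y|) ^ m.+2 * 2 ^ m.+2)).
    by apply: leq_mul; rewrite ?leq_exp2r ?leq_exp2l.
  rewrite -expnMn (_ : mu * #|Y| * 2 = #|Y| * (2 * mu)); last by lia.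
  by rewrite expnMn leq_mul2l leq_pexp2l ?orbT //; lia.
have E (a b d e Z : nat) : a * b <= d * e -> N * a * (7 * b * Z) <= d * (7 * e * (N * Z)).
  move=> ab; apply: (@leq_trans (7 * N * Z * (a * b))); [lia|].
  by rewrite (_ : d * _ = 7 * N * Z * (d * e)) ?leq_mul2l ?ab ?orbT //; lia.
exact: E.
Qed.

(** With [r = D ^ 2 * #|Y|], for which [r * tau] is the size of the host, a given [n]-set is
    independent with probability at most [2 ^ n / D ^ (n - r)]; the union bound runs over at most
    [2 ^ N] sets. *)
Lemma sum_indep (N n D tau : nat) : 0 < D ->
  #|Y| * tau * D ^ 2 = #|{: H}| -> 2 * (D ^ 2 * #|Y|) <= n ->
  2 ^ (N + n + 2) <= D ^ (n - D ^ 2 * #|Y|) ->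
  4 * \sum_(P : {ffun 'I_N -> H})
    #|[set I : {set 'I_N} | (#|I| == n) && pairwise (fun v w => ~~ adj v w) (map P (enum I))]|
  <= #|{: H}| ^ N.
Proof.
move=> D0 tauE rn Dbig; set h := #|{: H}| in tauE *; set r := D ^ 2 * #|Y| in rn Dbig.
pose S := \sum_(I : {set 'I_N} | #|I| == n)
   #|[set P : {ffun 'I_N -> H} | pairwise (fun v w => ~~ adj v w) (map P (enum I))]|.
have -> : \sum_(P : {ffun 'I_N -> H})
    #|[set I : {set 'I_N} | (#|I| == n) && pairwise (fun v w => ~~ adj v w) (map P (enum I))]| = S.
  under eq_bigr do rewrite -sum1dep_card.
  rewrite (exchange_big_dep (fun I : {set 'I_N} => #|I| == n)) /=; last by move=> ? ? _ /andP[].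
  apply: eq_bigr => I nI; rewrite -sum1dep_card.
  by apply: eq_bigl => P; rewrite nI.
have each (I : {set 'I_N}) : #|I| == n -> D ^ (n - r) *
    #|[set P : {ffun 'I_N -> H} | pairwise (fun v w => ~~ adj v w) (map P (enum I))]|
    <= 2 ^ n * h ^ N.
  move=> /eqP nI; have sI : size (enum I) == n by rewrite -cardE nI.
  have hp k : 0 < h ^ k by rewrite expn_gt0 h_gt0.
  have Dp : 0 < D ^ r by rewrite expn_gt0 D0.
  rewrite -(leq_pmul2r (hp n)) -(leq_pmul2l Dp) -mulnA.
  have := @card_marginal _ _ h0 _ (Tuple sI)
    (fun t => pairwise (fun v w => ~~ adj v w) (val t)) (enum_uniq _).
  rewrite card_ord -/h => /= ->; rewrite !mulnA -expnD subnKC; last by lia.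
  have cnt : D ^ n * #|[pred t : n.-tuple H | pairwise (fun v w => ~~ adj v w) (val t)]|
      <= (2 * h) ^ n * D ^ r.
    apply: leq_trans (@size_indep_seqs D tau setT n r D0 _ _).
    - rewrite leq_mul2l; apply/orP; right; apply: card_tuple_leq => t /= pt.
      have := @mem_indep_seqs setT t _ pt.
      by rewrite size_tuple; apply=> v; rewrite inE.
    - by rewrite tauE.
    - by rewrite cardsT -/h -tauE /r; lia.
  apply: leq_trans (leq_mul cnt (leqnn (h ^ N))) _.
  by rewrite expnMn; lia.
have SN : D ^ (n - r) * S <= 2 ^ N * (2 ^ n * h ^ N).
  rewrite /S big_distrr /=.
  apply: (@leq_trans (\sum_(I : {set 'I_N} | #|I| == n) 2 ^ n * h ^ N)).
    by apply: leq_sum => I; apply: each.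
  rewrite sum_nat_const leq_mul2r; apply/orP; right.
  apply: leq_trans (max_card _) _.
  by rewrite -cardsT -powersetT card_powerset cardsT card_ord.
have p2 k : 0 < 2 ^ k by rewrite expn_gt0.
rewrite -(leq_pmul2l (p2 (N + n))); apply: (@leq_trans (2 ^ (N + n + 2) * S)).
  by rewrite [2 ^ (_ + 2)]expnD mulnA.
apply: leq_trans (leq_mul Dbig (leqnn S)) _.
by rewrite expnD -mulnA.
Qed.

Lemma sparse_sample (N n D tau mu g : nat) :
  0 < N -> 0 < D -> 0 < mu ->
  #|Y| * tau * D ^ 2 = #|{: H}| -> 2 * (D ^ 2 * #|Y|) <= n ->
  2 ^ (N + n + 2) <= D ^ (n - D ^ 2 * #|Y|) ->
  N <= mu * #|Y| -> 28 * g * (2 * mu) ^ g.+2 <= #|J| ->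
  exists (P : {ffun 'I_N -> H}) (R : {set 'I_N}),
  [/\ 2 * #|R| < N,
      forall I : {set 'I_N}, #|I| = n ->
        exists i i', [/\ i \in I, i' \in I, i != i' & adj (P i) (P i')] &
      forall s : seq 'I_N, uniq s -> 3 <= size s < g ->
        cycle (fun i i' => adj (P i) (P i')) s -> exists2 i, i \in s & i \in R].
Proof.
move=> N0 D0 mu0 tauE rn Dbig Nmu Jbig; set h := #|{: H}|.
pose B (P : {ffun 'I_N -> H}) (m : nat) :=
  #|[set s : m.+3.-tuple 'I_N | uniq s && bad (map P s)]|.
pose F (P : {ffun 'I_N -> H}) :=
  #|[set I : {set 'I_N} | (#|I| == n) && pairwise (fun v w => ~~ adj v w) (map P (enum I))]|.
have sumB : 4 * \sum_P \sum_(m < g) B P m <= N * h ^ N.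
  have [J0|J_gt0] := posnP #|J|.
    by have := max_card (pred1 h0.2); rewrite card1 J0.
  rewrite -(leq_pmul2l J_gt0) exchange_big /= mulnCA [X in _ * X]big_distrr /=.
  apply: (@leq_trans (4 * (g * (7 * (2 * mu) ^ g.+2 * (N * h ^ N))))).
    rewrite leq_mul2l /=; apply: (@leq_trans (\sum_(m < g) 7 * (2 * mu) ^ g.+2 * (N * h ^ N))).
      by apply: leq_sum => m _; apply: sum_bad.
    by rewrite sum_nat_const card_ord.
  by apply: leq_trans (leq_mul Jbig (leqnn (N * h ^ N))); lia.
have sumF : 4 * \sum_P F P <= h ^ N by apply: sum_indep tauE rn Dbig.
(* The mean of the left side is at most [N / 2 + N / 4]. The weight [N] on [F P] forces
   [F P = 0]. *)
have [P] : exists P, 2 * \sum_(m < g) B P m + N * F P < N.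
  apply/existsP; rewrite -[X in is_true X]negbK negb_exists; apply/forallP => big.
  have : N * h ^ N <= \sum_(P : {ffun 'I_N -> H}) (2 * \sum_(m < g) B P m + N * F P).
    apply: (@leq_trans (\sum_(P : {ffun 'I_N -> H}) N)).
      by rewrite sum_nat_const card_ffun card_ord mulnC.
    by apply: leq_sum => P _; rewrite leqNgt; apply: big.
  have -> : \sum_(P : {ffun 'I_N -> H}) (2 * \sum_(m < g) B P m + N * F P) =
      2 * (\sum_P \sum_(m < g) B P m) + N * \sum_P F P.
    by rewrite big_split /= !big_distrr.
  have : 0 < N * h ^ N by rewrite muln_gt0 N0 expn_gt0 h_gt0.
  have : 4 * (N * \sum_P F P) <= N * h ^ N by rewrite mulnCA leq_mul2l sumF orbT.
  move: sumB; set a := \sum_P \sum_(m < g) _; set b := N * \sum_P _; set e := N * _.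
  by rewrite -/e; move: a b e => a b e; lia.
move=> PB; have FP0 : F P = 0 by case: (F P) PB => // f; rewrite mulnS; lia.
move: PB; rewrite FP0 muln0 addn0 => PB.
pose hd m (s : m.+3.-tuple 'I_N) := thead s.
pose R := \bigcup_(m < g) [set hd m s | s in [set s : m.+3.-tuple 'I_N | uniq s && bad (map P s)]].
exists P, R; split.
- apply: leq_ltn_trans PB; rewrite leq_mul2l /= /R.
  elim/big_rec2: _ => [|m A b _ IH]; first by rewrite cards0.
  apply: leq_trans (leq_card_setU _ _) _; apply: leq_add IH.
  exact: leq_imset_card.
- move=> I nI.
  have : I \notin [set I : {set 'I_N} | (#|I| == n) &&
       pairwise (fun v w => ~~ adj v w) (map P (enum I))].
    by move/eqP: FP0; rewrite cards_eq0 => /eqP->; rewrite inE.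
  rewrite inE nI eqxx /= => npw.
  have [/existsP[i /existsP[i' /and4P[]]]|] := boolP
    [exists i, exists i', [&& i \in I, i' \in I, i != i' & adj (P i) (P i')]].
    by exists i, i'.
  move=> no; case/negP: npw; rewrite pairwise_map.
  have := enum_uniq I; rewrite uniq_pairwise.
  apply: (@sub_in_pairwise _ [in I]); last by apply/allP => i; rewrite mem_enum.
  move=> i i' iI i'I /= ii'; apply/negP => aii'; case/negP: no.
  by apply/existsP; exists i; apply/existsP; exists i'; rewrite iI i'I ii'.
move=> s us /andP[s3 sg] cs.
have inR t : uniq t -> size t = size s -> bad (map P t) -> exists2 i, i \in t & i \in R.
  move=> ut st bt; have st' : size t == (size s - 3).+3 by apply/eqP; lia.
  have mg : size s - 3 < g by lia.
  exists (hd _ (Tuple st')).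
    by rewrite /hd /thead (tnth_nth (hd _ (Tuple st'))) mem_nth // (eqP st').
  apply/bigcupP; exists (Ordinal mg) => //.
  by apply/imsetP; exists (Tuple st'); rewrite ?inE ?ut.
(* Rotating [s] keeps its vertices, so a deleted vertex of the rotation also lies on [s]. *)
have := @cycle_bad (map P s); rewrite size_map s3 cycle_map.
case/(_ isT cs)/orP => [|b1]; first exact: inR.
rewrite -map_rot in b1.
have [i] : exists2 i, i \in rot 1 s & i \in R.
  by apply: inR b1; rewrite ?rot_uniq ?size_rot.
by rewrite mem_rot; exists i.
Qed.

End Host.

(** * The grid and its partitions into boxes *)

Section Grid.

Variables (B q : nat).
Local Notation X := ('I_(B * q ^ q) * 'I_(q ^ q))%type.
Hypothesis q_gt0 : 0 < q.

(* The number of the cell of side lengths [q ^ j] and [q ^ (q - j)] that contains [p]. *)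
Definition cell (j : 'I_q) (p : X) : 'I_(B * q ^ q) :=
  insubd p.1 (p.1 %/ q ^ j * q ^ j + p.2 %/ q ^ (q - j)).

(** The row number is less than [q ^ j], so the cell number is a two-digit expansion that determines
    both digits. It stays below [B * q ^ q], so the default of [insubd] never occurs. *)
Lemma cell_eq j p p' : (cell j p == cell j p') =
  (p.1 %/ q ^ j == p'.1 %/ q ^ j) && (p.2 %/ q ^ (q - j) == p'.2 %/ q ^ (q - j)).
Proof.
have qj k : 0 < q ^ k by rewrite expn_gt0 q_gt0.
have qqE : q ^ q = q ^ (q - j) * q ^ j by rewrite -expnD subnK // ltnW.
have lt2 (u : X) : u.2 %/ q ^ (q - j) < q ^ j.
  by rewrite ltn_divLR //; apply: leq_trans (ltn_ord u.2) _; rewrite qqE mulnC.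
have valE (u : X) : val (cell j u) = u.1 %/ q ^ j * q ^ j + u.2 %/ q ^ (q - j).
  rewrite /cell val_insubd.
  have -> // : u.1 %/ q ^ j * q ^ j + u.2 %/ q ^ (q - j) < B * q ^ q.
  apply: (@leq_trans ((u.1 %/ q ^ j).+1 * q ^ j)).
    by rewrite mulSn addnC ltn_add2r.
  rewrite [leqRHS](_ : _ = B * q ^ (q - j) * q ^ j); last by rewrite -mulnA -qqE.
  rewrite leq_mul2r ltn_divLR //; apply/orP; right.
  by apply: leq_trans (ltn_ord u.1) _; rewrite -mulnA -qqE.
rewrite -(inj_eq val_inj) !valE; apply/eqP/andP => [E|[/eqP -> /eqP -> //]].
have dE (u : X) : (u.1 %/ q ^ j * q ^ j + u.2 %/ q ^ (q - j)) %/ q ^ j = u.1 %/ q ^ j.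
  by rewrite divnMDl // (divn_small (lt2 u)) addn0.
have /eqP E1 : p.1 %/ q ^ j == p'.1 %/ q ^ j by rewrite -dE E dE.
by split; apply/eqP => //; move: E; rewrite E1 => /addnI.
Qed.

Lemma card_divn_eq M d a : 0 < d -> #|[set x : 'I_M | x %/ d == a]| <= d.
Proof.
move=> d0; rewrite cardE -(size_map val) -[leqRHS](size_iota (a * d) d).
apply: uniq_leq_size => [|_ /mapP[x + ->]].
  by rewrite map_inj_uniq ?enum_uniq //; apply: val_inj.
rewrite mem_enum inE mem_iota => /eqP <-.
by rewrite leq_divM [x in x < _](divn_eq x d) ltn_add2l ltn_mod.
Qed.

Lemma cell_card j y : #|[set p | cell j p == y]| <= q ^ q.
Proof.
have qj k : 0 < q ^ k by rewrite expn_gt0 q_gt0.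
have [->|[p0]] := set_0Vmem [set p | cell j p == y]; first by rewrite cards0.
rewrite inE => /eqP yE.
rewrite [leqRHS](_ : _ = q ^ j * q ^ (q - j)); last by rewrite -expnD subnKC // ltnW.
apply: leq_trans (leq_mul (card_divn_eq _ (p0.1 %/ q ^ j) (qj j))
  (card_divn_eq _ (p0.2 %/ q ^ (q - j)) (qj (q - j)))).
rewrite -cardsX; apply/subset_leq_card/subsetP => p.
by rewrite !inE -yE cell_eq.
Qed.

(** For [j < j'] the intersection has sides at most [q ^ j] and [q ^ (q - j')], hence area at most
    [q ^ (q - 1)]. *)
Lemma cell_cap j j' y y' : j != j' ->
  #|[set p | (cell j p == y) && (cell j' p == y')]| * #|'I_q| <= q ^ q.
Proof.
have qj k : 0 < q ^ k by rewrite expn_gt0 q_gt0.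
rewrite card_ord; wlog jj' : j j' y y' / j < j' => [wl|_].
  rewrite neq_ltn => /orP[jj'|j'j]; first by apply: wl; rewrite // neq_ltn jj'.
  rewrite (_ : [set p | _] = [set p | (cell j' p == y') && (cell j p == y)]).
    by apply: wl; rewrite // neq_ltn j'j.
  by apply/setP => p; rewrite !inE andbC.
have [->|[p0]] := set_0Vmem [set p | (cell j p == y) && (cell j' p == y')].
  by rewrite cards0.
rewrite inE => /andP[/eqP yE /eqP y'E].
apply: (@leq_trans (q ^ j * q ^ (q - j') * q ^ 1)); last first.
  by rewrite -!expnD leq_pexp2l //; have := ltn_ord j'; lia.
rewrite expn1 leq_mul2r; apply/orP; right.
apply: leq_trans (leq_mul (card_divn_eq _ (p0.1 %/ q ^ j) (qj j))
  (card_divn_eq _ (p0.2 %/ q ^ (q - j')) (qj (q - j')))).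
rewrite -cardsX; apply/subset_leq_card/subsetP => p.
by rewrite !inE -yE -y'E !cell_eq => /andP[/andP[-> _] /andP[_ ->]].
Qed.

End Grid.

(** * Box graphs as semilinear graphs *)

Local Open Scope ring_scope.

Lemma subset_map_preimage (S T : eqType) (f : S -> T) (t : seq S) (c : seq T) :
  {subset c <= map f t} -> exists2 s, c = map f s & {subset s <= t}.
Proof.
elim: c => [|y c IH] ct; first by exists [::].
have [x xt ->] := mapP (ct y (mem_head _ _)).
have [|s -> st] := IH; first by move=> z zc; apply: ct; rewrite inE zc orbT.
by exists (x :: s) => // z; rewrite inE => /predU1P[->|/st].
Qed.

Section Boxes.

Variables (N : nat) (px py xlo xhi ylo yhi : 'I_N -> nat) (W : {set 'I_N}).

Definition in_box (i k : 'I_N) : bool :=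
  (xlo i <= px k < xhi i)%N && (ylo i <= py k < yhi i)%N.

Definition box_adj (i k : 'I_N) : bool := in_box i k || in_box k i.

(** The index comes first to keep rows distinct when the same host vertex is sampled twice. *)
Definition box_row (i : 'I_N) : 'rV[R]_7 := \row_k
  (nth 0%N [:: val i; px i; py i; xlo i; xhi i; ylo i; yhi i] k)%:R.

Definition fwd (a b : nat) : lin2 7 :=
  Lin2 0 (- delta_mx 0 (inord b)) (delta_mx 0 (inord a)).
Definition bwd (a b : nat) : lin2 7 :=
  Lin2 0 (delta_mx 0 (inord a)) (- delta_mx 0 (inord b)).

Lemma sum_delta_row d (k : 'I_d) (x : 'rV[R]_d) :
  \sum_(i < d) delta_mx (0 : 'I_1) k 0 i * x 0 i = x 0 k.
Proof.
rewrite (bigD1 k) //= big1 => [|i ik]; first by rewrite mxE !eqxx mul1r addr0.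
by rewrite mxE (negbTE ik) andbF mul0r.
Qed.

Lemma fwdE a b x y : lin2_eval (fwd a b) x y = y 0 (inord a) - x 0 (inord b).
Proof.
rewrite /lin2_eval /fwd /= !RplusE add0r sum_delta_row.
under eq_bigr do rewrite mxE mulNr.
by rewrite sumrN sum_delta_row addrC.
Qed.

Lemma bwdE a b x y : lin2_eval (bwd a b) x y = x 0 (inord a) - y 0 (inord b).
Proof.
rewrite /lin2_eval /bwd /= !RplusE add0r sum_delta_row.
under [X in _ + X]eq_bigr do rewrite mxE mulNr.
by rewrite sumrN sum_delta_row.
Qed.

(** Four tests place the point of the second vertex in the half-open box of the first, and four do
    so with the roles exchanged. The component [.1.1] is the truth value of [< 0]. *)
Definition box_graph : semilinear_graph 7 8 :=
  SLGraph [seq box_row i | i <- enum W]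
    (fun k => nth (fwd 0 0)
      [:: fwd 1 3; fwd 1 4; fwd 2 5; fwd 2 6; bwd 1 3; bwd 1 4; bwd 2 5; bwd 2 6] k)
    (fun p => let neg k := (p (inord k)).1.1 in
      [&& ~~ neg 0%N, neg 1%N, ~~ neg 2%N & neg 3%N] ||
      [&& ~~ neg 4%N, neg 5%N, ~~ neg 6%N & neg 7%N]).

Lemma box_row_inj : injective box_row.
Proof.
move=> i k /matrixP/(_ 0 0); rewrite !mxE /= => /eqP; rewrite eqr_nat => /eqP.
exact: val_inj.
Qed.

Lemma box_phi i k :
  sl_phi box_graph (sign_pattern (sl_f box_graph) (box_row i) (box_row k)) =
  box_adj i k.
Proof.
rewrite /= !ffunE !inordK //= !fwdE !bwdE !mxE !inordK //= !subr_lt0 !ltr_nat.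
by rewrite -!leqNgt /box_adj /in_box -!andbA.
Qed.

Lemma box_graph_wf : sl_wf box_graph.
Proof.
split=> //; split; first by rewrite /= (map_inj_uniq box_row_inj) enum_uniq.
by move=> _ _ /mapP[i _ ->] /mapP[k _ ->] _; rewrite !box_phi /box_adj orbC.
Qed.

Lemma box_sl_adj i k : sl_adj box_graph (box_row i) (box_row k) =
  [&& i \in W, k \in W, i != k & box_adj i k].
Proof.
rewrite /sl_adj box_phi (inj_eq box_row_inj) !(mem_map box_row_inj).
by rewrite !mem_enum.
Qed.

Lemma box_graph_girth g :
  (forall s, uniq s -> {subset s <= W} -> (3 <= size s < g)%N -> ~~ cycle box_adj s) ->
  girth_at_least (sl_V box_graph) (sl_adj box_graph) g.
Proof.
move=> noc k kg [c [k3 sk uc /subset_map_preimage[s cE sW] cc]].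
move: sk uc cc; rewrite {c}cE size_map cycle_map => sk /map_uniq us cc.
have sW' : {subset s <= W} by move=> i /sW; rewrite mem_enum.
have /negP[] : ~~ cycle box_adj s by apply: noc; rewrite ?sk ?k3.
apply: sub_cycle cc => i j /=.
by rewrite box_sl_adj => /and4P[].
Qed.

Lemma box_graph_indep n :
  (forall I : {set 'I_N}, I \subset W -> #|I| = n ->
     exists i k, [/\ i \in I, k \in I, i != k & box_adj i k]) ->
  ~ has_independent_set (sl_V box_graph) (sl_adj box_graph) n.
Proof.
move=> dep [c [sn uc /subset_map_preimage[s cE sW] noadj]].
move: sn uc noadj; rewrite {c}cE size_map => sn /map_uniq us noadj.
have [|| i [k]] := dep [set i in s].
- by apply/subsetP => i; rewrite inE => /sW; rewrite mem_enum.
- by rewrite cardsE (card_uniqP us).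
rewrite !inE => -[si sk ik aik].
have /negP[] := noadj _ _ (map_f box_row si) (map_f box_row sk).
by move: (sW _ si) (sW _ sk); rewrite !mem_enum box_sl_adj ik aik => -> ->.
Qed.

End Boxes.

(** * Choice of the parameters *)

Lemma eq_divn_interval (d a x : nat) : (0 < d)%N ->
  (a %/ d == x %/ d)%N = (a %/ d * d <= x < a %/ d * d + d)%N.
Proof.
move=> d0; rewrite eqn_leq leq_divRL //; congr (_ && _).
by rewrite -ltnS ltn_divLR // mulSn addnC.
Qed.

Lemma dense_semilinear_graph (g K B n : nat) :
  let e := (100 * K * g)%N in
  let r := (2 ^ (8 * K + 12) * (B * (2 ^ e) ^ (2 ^ e)))%N in
  (0 < g)%N -> (0 < K)%N -> (0 < B)%N -> (2 * r <= n < 4 * r)%N ->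
  exists G : semilinear_graph 7 8,
    [/\ sl_wf G,
        girth_at_least (sl_V G) (sl_adj G) g,
        ~ has_independent_set (sl_V G) (sl_adj G) n &
        (K * n <= sl_nverts G)%N].
Proof.
move=> e r g0 K0 B0 /andP[rn nr].
(* As [n - r >= n / 2], the exponent [4 * K + 6] of [D] beats the union bound [2 ^ (N + n + 2)]. The
   constant 100 in [e] makes [q] exceed [28 * g * (2 * mu) ^ g.+2] for [mu = 8 * K * D ^ 2]. *)
pose q := (2 ^ e)%N; pose D := (2 ^ (4 * K + 6))%N; pose Q := (B * q ^ q)%N.
have q0 : (0 < q)%N by rewrite expn_gt0.
have qq0 : (0 < q ^ q)%N by rewrite expn_gt0 q0.
have D2 : (D ^ 2 = 2 ^ (8 * K + 12))%N by rewrite -expnM; congr (_ ^ _)%N; lia.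
have Q0 : (0 < Q)%N by rewrite muln_gt0 B0.
have D0 : (0 < D)%N by rewrite expn_gt0.
have rE : r = (D ^ 2 * Q)%N by rewrite D2.
have r0 : (0 < r)%N by rewrite rE muln_gt0 Q0 expn_gt0 D0.
have n0 : (0 < n)%N by lia.
have h0 : ('I_Q * 'I_(q ^ q) * 'I_q)%type := (Ordinal Q0, Ordinal qq0, Ordinal q0).
(* Fewer than half of these vertices get deleted, so [K * n] remain. *)
pose N := (2 * K * n)%N.
have eK : (8 * K + 12 <= e)%N by rewrite /e; nia.
have [||||||||| P [S [S2 Pn Pg]]] := @sparse_sample _ _ _ (@cell B q) (q ^ q)
    (@cell_card B q q0) (@cell_cap B q q0) _ h0 N n D
    (2 ^ (e * q.+1 - (8 * K + 12))) (8 * K * D ^ 2) g.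
- by rewrite card_prod !card_ord.
- by rewrite /N !muln_gt0 K0.
- exact: D0.
- by rewrite !muln_gt0 K0 D0.
- rewrite D2 -mulnA -expnD subnK; last by rewrite mulnS; lia.
  by rewrite expnM expnS !card_prod !card_ord mulnA mulnAC.
- by rewrite card_ord -rE.
- rewrite card_ord -rE -expnM leq_exp2l // /N; nia.
- by rewrite card_ord -mulnA -rE /N; move: nr; clear; nia.
- rewrite card_ord.
  have mu2 : (2 * (8 * K * D ^ 2) <= 2 ^ (25 * K))%N.
    apply: (@leq_trans (2 ^ 4 * 2 ^ K * 2 ^ (8 * K + 12))).
      by have := ltn_expl K (isT : 1 < 2)%N; rewrite D2; nia.
    by rewrite -!expnD leq_exp2l //; lia.
  apply: (@leq_trans (2 ^ 5 * 2 ^ g * (2 ^ (25 * K)) ^ g.+2)).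
    apply: leq_mul; last by rewrite leq_exp2r.
    by apply: leq_mul => //; apply/ltnW/ltn_expl.
  by rewrite -expnM -!expnD leq_exp2l // /e; nia.
pose d i := ((q ^ (P i).2)%N, (q ^ (q - (P i).2))%N).
pose lo1 i := ((P i).1.1 %/ (d i).1 * (d i).1)%N.
pose lo2 i := ((P i).1.2 %/ (d i).2 * (d i).2)%N.
pose G := box_graph (fun i => (P i).1.1) (fun i => (P i).1.2)
  lo1 (fun i => lo1 i + (d i).1)%N lo2 (fun i => lo2 i + (d i).2)%N (~: S).
have adjE i k : box_adj (fun i => (P i).1.1) (fun i => (P i).1.2)
  lo1 (fun i => lo1 i + (d i).1)%N lo2 (fun i => lo2 i + (d i).2)%N i k
    = adj (@cell B q) (P i) (P k).
  by rewrite /box_adj /adj /in_box /out !cell_eq // !eq_divn_interval // expn_gt0 q0.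
exists G; split.
- exact: box_graph_wf.
- apply: box_graph_girth => s us sS s3; apply/negP => cs.
  have [|i /sS + iS] := Pg s us s3; last by rewrite inE iS.
  by rewrite -(eq_cycle adjE).
- apply: box_graph_indep => I _ /Pn[i [k [iI kI ik ak]]].
  by exists i, k; rewrite adjE.
rewrite /sl_nverts size_map -cardE -(leq_add2l #|S|) cardsC card_ord.
by move: S2; rewrite /N; lia.
Qed.

(** This serves the small values of [n]. With all bounds zero the half-open boxes are empty. *)
Lemma edgeless_semilinear_graph (g n : nat) :
  exists G : semilinear_graph 7 8,
    [/\ sl_wf G,
        girth_at_least (sl_V G) (sl_adj G) g,
        ~ has_independent_set (sl_V G) (sl_adj G) n.+1 &
        sl_nverts G = n].
Proof.
pose z (i : 'I_n) := 0%N.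
exists (box_graph z z z z z z setT); split.
- exact: box_graph_wf.
- by apply: box_graph_girth => -[|i [|k s]].
- apply: box_graph_indep => I _ cI.
  by have := max_card I; rewrite cI card_ord ltnn.
by rewrite /sl_nverts size_map -cardE cardsT card_ord.
Qed.

(** * Double logarithms and the final assembly *)

Lemma ler_ln (x y : R) : 0 < x -> x <= y -> ln x <= ln y.
Proof.
move=> x0; rewrite le_eqVlt => /predU1P[-> //|xy].
by apply/ltW/RltP/ln_increasing; apply/RltP.
Qed.

Lemma ln_ln_le (n L : nat) : (3 <= n)%N -> (n < 2 ^ 2 ^ L)%N -> ln (ln n%:R) <= L%:R.
Proof.
move=> n3 nL.
have n0 : 0 < n%:R :> R by rewrite ltr0n; apply: leq_trans n3.
have ln2 : ln 2%:R <= 1.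
  have e1 : 2%:R <= exp 1 by apply/RleP/exp_ineq1_le.
  by apply: le_trans (ler_ln _ e1) _; rewrite ?ltr0n // ln_exp.
have ln2X k : ln (2%:R ^+ k) <= k%:R.
  rewrite -RpowE ln_pow; last by apply/RltP; rewrite ltr0n.
  by rewrite INRE RmultE ler_piMr.
have lnn : 0 < ln n%:R.
  have : Rlt (ln 1) (ln n%:R).
    by apply: ln_increasing; apply/RltP; rewrite ?ltr01 // ltr1n; apply: leq_trans n3.
  by rewrite ln_1 => /RltP.
apply: le_trans (ln2X L); apply: ler_ln => //.
rewrite -natrX; apply: le_trans (ln2X (2 ^ L)%N); apply: ler_ln => //.
by rewrite -natrX ler_nat ltnW.
Qed.

Theorem theorem1p3 :
  exists t : nat, (0 < t)%N /\
  forall g : nat, (0 < g)%N ->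
  exists c : R, 0 < c /\
  forall n : nat, (3 <= n)%N ->
  exists (d : nat) (G : semilinear_graph d t),
    [/\ sl_wf G,
        girth_at_least (sl_V G) (sl_adj G) g,
        ~ has_independent_set (sl_V G) (sl_adj G) n &
        c * n%:R * ln (ln n%:R) <= (sl_nverts G)%:R].
Proof.
exists 8; split=> // g g0.
exists ((2 * (400 * g))%:R^-1); split; first by rewrite invr_gt0 ltr0n !muln_gt0 g0.
move=> n n3; exists 7.
(* This [K] is the largest with [4 * e <= L] for [e = 100 * K * g]. Passing from [K.+1] to [K]
   accounts for the factor 2 in the constant. *)
pose L := trunc_log 2 (trunc_log 2 n); pose K := (L %/ (400 * g))%N.
have n0 : (0 < n)%N by lia.
have l0 : (0 < trunc_log 2 n)%N by rewrite trunc_log_gt0; lia.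
have LK : ln (ln n%:R) <= (400 * g * K.+1)%:R.
  apply: (@le_trans _ _ L.+1%:R); last first.
    by rewrite ler_nat mulnC; apply: ltn_ceil; rewrite muln_gt0.
  apply: ln_ln_le => //; apply: leq_trans (trunc_log_ltn n (isT : 1 < 2)%N) _.
  by rewrite leq_exp2l // trunc_log_ltn.
suff [G [wfG gG iG nG]] : exists G : semilinear_graph 7 8,
    [/\ sl_wf G, girth_at_least (sl_V G) (sl_adj G) g,
      ~ has_independent_set (sl_V G) (sl_adj G) n & (K.+1 * n <= 2 * sl_nverts G)%N].
  exists G; split=> //; rewrite -mulrA ler_pdivrMl; last by rewrite ltr0n !muln_gt0 g0.
  apply: le_trans (ler_wpM2l (ler0n _ n) LK) _.
  rewrite -!natrM ler_nat; move: (400 * g)%N => a.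
  rewrite mulnCA -mulnA [leqRHS]mulnCA leq_mul2l; apply/orP; right.
  by rewrite mulnC.
(* For [K = 0] it suffices to have [n / 2] vertices, and [n - 1] isolated ones will do. *)
have [K0|Kpos] := posnP K.
  rewrite K0; case: n n3 {n0 L l0 LK K K0} => // n n3.
  have [G [wfG gG iG nG]] := edgeless_semilinear_graph g n.
  by exists G; split=> //; rewrite nG; lia.
pose e := (100 * K * g)%N.
pose b := (2 ^ (8 * K + 12) * (2 ^ e) ^ (2 ^ e))%N.
(* With [T = 2 ^ e], the binary logarithm of [2 * b] is [8 * K + 13 + e * T <= T + T * T <= T ^ 4 =
   2 ^ (4 * e) <= 2 ^ L]. *)
have bn : (2 * b <= n)%N.
  apply: leq_trans (trunc_logP (isT : 1 < 2)%N n0).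
  rewrite /b -expnM -expnD -expnS leq_exp2l //.
  apply: leq_trans (trunc_logP (isT : 1 < 2)%N l0).
  apply: (@leq_trans (2 ^ (4 * e))); last first.
    by rewrite leq_exp2l //; have := leq_divM L (400 * g); rewrite -/K /e; lia.
  have eK : (8 * K + 13 <= e)%N by rewrite /e; nia.
  have e2 := ltn_expl e (isT : 1 < 2)%N.
  rewrite (_ : 4 * e = e + e + (e + e))%N; last by lia.
  rewrite !expnD; move: (2 ^ e)%N e2 eK => T eT eK.
  apply: (@leq_trans (T + T * T)); first by nia.
  have [T0 T2] : (0 < T)%N /\ (2 <= T)%N by lia.
  apply: (@leq_trans (T * T * 2)); first by rewrite muln2 -addnn leq_add2r leq_pmulr.
  by rewrite leq_mul2l (leq_trans T2) ?orbT // leq_pmulr.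
have b0 : (0 < b)%N by rewrite muln_gt0 !expn_gt0.
(* Stretching the grid by [B] reaches every [n]: [2 * b * B <= n < 2 * b * B.+1 <= 4 * b * B]. *)
pose B := (n %/ (2 * b))%N.
have B0 : (0 < B)%N by rewrite divn_gt0 ?bn // muln_gt0.
have [|G [wfG gG iG nG]] := @dense_semilinear_graph g K B n g0 Kpos B0.
  rewrite -/e mulnCA -/b; have := leq_divM n (2 * b).
  have : (0 < 2 * b)%N by rewrite muln_gt0.
  by move/(ltn_ceil n); rewrite -/B; move: B0; nia.
exists G; split=> //; apply: leq_trans (leq_mul (leqnn 2) nG).
by rewrite mulSn; nia.
Qed.
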